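(* Let $G$ be a connected graph on $n\ge 2$ vertices. Then $$\overline{B_S}(G)=\frac1n\left((2^n-n-1)\,\overline{SW}(G)-2^{n-1}(n-2)-1\right).$$
   Context: All graphs are finite, simple and undirected. For a connected graph $G$ and $S\subseteq V(G)$, the Steiner diversity $\delta(S)$ is the minimum number of edges of a connected subgraph of $G$ whose vertex set contains $S$. A connected subgraph of $G$ whose vertex set contains $S$ and which has exactly $\delta(S)$ edges is a tree, called a Steiner tree on $S$. The vertices in $S$ are its terminal vertices; its other vertices are its non-terminal vertices. The total Steiner Wiener index of $G$ is $SW(G)=\sum_{S\subseteq V(G),\,|S|\ge 2}\delta(S)$, and the average Steiner diversity of a graph $G$ on $n$ vertices is $\overline{SW}(G)=\frac{1}{2^n-n-1}SW(G)$. The total Steiner betweenness centrality of a vertex $v\in V(G)$ is $$B_S(v)=\sum_{\substack{A\subseteq V(G)\setminus\{v\}\\ |A|\ge 2}}\frac{\sigma_A(v)}{\sigma_A},$$ where $\sigma_A$ is the number of all Steiner trees on $A$ in $G$ and $\sigma_A(v)$ is the number of all Steiner trees on $A$ in $G$ that include $v$ as a non-terminal vertex. The average Steiner betweenness of a graph $G$ on $n$ vertices is $\overline{B_S}(G)=\frac1n\sum_{v\in V(G)}B_S(v)$. (The subscript $S$ in $B_S$ is just notation, standing for ''Steiner''.) *)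

(* Defs.v *)
From mathcomp Require Import all_boot all_order all_algebra.

Set Implicit Arguments.
Unset Strict Implicit.
Unset Printing Implicit Defensive.

Import Order.TTheory GRing.Theory Num.Theory.

(* A finite simple graph is a finite vertex type [T] with an adjacency         *)
(* relation [e : rel T] that is symmetric and irreflexive; these hypotheses,   *)
(* and connectedness, are assumed in theorems rather than in the definitions.  *)

Definition connected_graph (T : finType) (e : rel T) : Prop :=
  0 < #|T| /\ forall x y : T, connect e x y.

Definition edges (T : finType) (e : rel T) : {set {set T}} :=
  [set [set p.1; p.2] | p : T * T & e p.1 p.2].

(* A pair (vertex set, edge set), edges being two-element sets of vertices. *)
Definition vepair (T : finType) : Type := ({set T} * {set {set T}})%type.

Definition whole (T : finType) (e : rel T) : vepair T := ([set: T], edges e).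

Definition is_subgraph (T : finType) (e : rel T) (H : vepair T) : bool :=
  (H.2 \subset edges e) && [forall E in H.2, E \subset H.1].

Definition vepair_connected (T : finType) (H : vepair T) : bool :=
  (H.1 != set0) &&
  [forall x in H.1, forall y in H.1,
     connect [rel a b | [set a; b] \in H.2] x y].

Definition connects (T : finType) (e : rel T) (S : {set T}) (H : vepair T) :
    bool :=
  [&& is_subgraph e H, vepair_connected H & S \subset H.1].

(* The default value [whole e] of the arg min matters only if the graph is     *)
(* disconnected: see [whole_connects] and [steiner_divP].                      *)
Definition steiner_div (T : finType) (e : rel T) (S : {set T}) : nat :=
  #|[arg min_(H < whole e | connects e S H) #|H.2|].2|.

Definition steiner_trees (T : finType) (e : rel T) (S : {set T}) :
    {set vepair T} :=
  [set H : {set T} * {set {set T}} |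
     connects e S H && (#|H.2| == steiner_div e S)].

Definition SW (T : finType) (e : rel T) : nat :=
  \sum_(S : {set T} | 2 <= #|S|) steiner_div e S.

Definition sigma (T : finType) (e : rel T) (A : {set T}) : nat :=
  #|steiner_trees e A|.

Definition sigma_at (T : finType) (e : rel T) (A : {set T}) (v : T) : nat :=
  #|[set H in steiner_trees e A | v \in H.1 :\: A]|.

Local Open Scope ring_scope.

Definition avg_SW (T : finType) (e : rel T) : rat :=
  (2 ^+ #|T| - #|T|%:R - 1)^-1 * (SW e)%:R.

Definition BS (T : finType) (e : rel T) (v : T) : rat :=
  \sum_(A : {set T} | (A \subset ~: [set v]) && (2 <= #|A|)%N)
    (sigma_at e A v)%:R / (sigma e A)%:R.

Definition avg_BS (T : finType) (e : rel T) : rat :=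
  (#|T|%:R)^-1 * \sum_(v : T) BS e v.

Local Close Scope ring_scope.

Lemma whole_connects (T : finType) (e : rel T) (S : {set T}) :
  connected_graph e -> connects e S (whole e).
Proof.
move=> [T0 ce]; apply/and3P; split; last exact: subsetT.
  by apply/andP; split=> //; apply/forall_inP=> E _; apply: subsetT.
apply/andP; split; first by rewrite -card_gt0 cardsT.
apply/forall_inP=> x _; apply/forall_inP=> y _.
apply: connect_sub (ce x y) => a b eab; apply: connect1 => /=.
by apply/imsetP; exists (a, b); rewrite ?inE.
Qed.

Lemma steiner_divP (T : finType) (e : rel T) (S : {set T}) :
  connected_graph e ->
  (exists2 H, connects e S H & #|H.2| = steiner_div e S) /\
  (forall H, connects e S H -> steiner_div e S <= #|H.2|).
Proof.
move=> ce; rewrite /steiner_div.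
by case: arg_minnP => [|H cH minH]; [exact: whole_connects | split=> //; exists H].
Qed.

(* Main.v *)
Require Import Defs.
From mathcomp Require Import all_boot all_order all_algebra.
From mathcomp Require Import zify ring.

Set Implicit Arguments.
Unset Strict Implicit.

Import Order.TTheory GRing.Theory Num.Theory.
Local Open Scope ring_scope.

(** Summing the betweenness over all vertices and exchanging sums, each set [A]
    with at least two elements contributes the mean, over the Steiner trees [H]
    on [A], of the number of vertices of [H] outside [A].  A Steiner tree on [A]
    has exactly [steiner_div e A + 1] vertices ([steiner_tree_card]), so this
    number is [steiner_div e A + 1 - #|A|] whatever [H] is, and the total
    betweenness is [SW e] minus the sum of [#|A| - 1] over these sets [A]; that
    last sum is [2 ^ n.-1 * (n - 2) + 1] ([sum_card_pred]).

    The vertex count of a Steiner tree comes from spanning trees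
    ([spanning_tree]): a connected [(V, F)] contains a connected [(V, F')] with
    [F'] a subset of [F] having [#|V| - 1] edges.  The tree is built from
    shortest paths to a root: every other vertex picks an edge towards a vertex
    closer to the root, and different vertices pick different edges. *)

(** The witnesses are the breadth-first structure of the component of [r]: [d] is
    the distance from [r], and [p] maps a vertex to its predecessor on some
    shortest path from [r]. *)
Lemma connect_parent (T : finType) (e : rel T) (r : T) :
  exists (d : T -> nat) (p : T -> T), forall x, connect e r x -> x != r ->
    [/\ connect e r (p x), e (p x) x & (d (p x) < d x)%N].
Proof.
pose P x n := [exists t : n.-tuple T, path e r t && (last r t == x)].
have pathP x (t : seq T) : path e r t -> last r t = x -> P x (size t).
  by move=> et lt; apply/existsP; exists (in_tuple t); rewrite et lt eqxx.
have exP x : connect e r x -> exists n, P x n.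
  by case/connectP=> t et lt; exists (size t); apply: pathP.
pose d x := if connect e r x =P true is ReflectT rx then ex_minn (exP x rx)
            else 0.
have d_le x (t : seq T) : path e r t -> last r t = x -> (d x <= size t)%N.
  move=> et lt; rewrite /d; case: eqP => // rx.
  by case: ex_minnP => m _; apply; apply: pathP.
have d_ex x : connect e r x ->
    exists t, [/\ path e r t, last r t = x & size t = d x].
  move=> rx; rewrite /d; case: eqP => // rx'.
  case: ex_minnP => m /existsP[t /andP[et /eqP lt]] _.
  by exists t; rewrite size_tuple.
pose ok x y := [&& connect e r y, e y x & (d y < d x)%N].
exists d, (fun x => odflt x [pick y | ok x y]) => x rx x_r.
case: pickP => [y /and3P[] // | no_y].
have [t [et lt szt]] := d_ex x rx.
case/lastP: t et lt szt => [|t z]; first by move=> _ /= rE; rewrite rE eqxx in x_r.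
rewrite rcons_path last_rcons size_rcons => /andP[et ez] zE szt.
have /negP[] := negbT (no_y (last r t)).
apply/and3P; split; first by apply/connectP; exists t.
  by rewrite -zE.
by rewrite -szt ltnS d_le.
Qed.

Lemma spanning_tree (T : finType) (V : {set T}) (F : {set {set T}}) :
    (forall E, E \in F -> E \subset V) -> vepair_connected (V, F) ->
  exists F' : {set {set T}},
    [/\ F' \subset F, vepair_connected (V, F') & #|F'|.+1 = #|V|].
Proof.
move=> FV /andP[/= /set0Pn[r rV] /forall_inP conF].
have con_r x : x \in V -> connect [rel a b | [set a; b] \in F] r x.
  by move=> xV; have /forall_inP := conF r rV; apply.
have [d [p dpP]] := connect_parent [rel a b | [set a; b] \in F] r.
have parP x : x \in V -> x != r ->
    [/\ p x \in V, [set p x; x] \in F & (d (p x) < d x)%N].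
  move=> xV x_r; have [_ /= px dx] := dpP x (con_r x xV) x_r; split=> //.
  by apply: (subsetP (FV _ px)); rewrite !inE eqxx.
exists [set [set p x; x] | x in V :\ r]; split.
- apply/subsetP=> E /imsetP[x /setD1P[x_r xV] ->].
  by have [] := parP x xV x_r.
- apply/andP; split=> /=; first by apply/set0Pn; exists r.
  set e' := [rel a b | _].
  have e'C : connect_sym e' by apply: sym_connect_sym => a b /=; rewrite setUC.
  suff rootP m x : x \in V -> (d x <= m)%N -> connect e' r x.
    apply/forall_inP=> x xV; apply/forall_inP=> y yV.
    apply: (@connect_trans _ _ r); last exact: rootP yV (leqnn _).
    by rewrite e'C; apply: rootP xV (leqnn _).
  elim: m x => [|m IHm] x xV dxm; have [-> //|x_r] := eqVneq x r;
    have [pV _ dx] := parP x xV x_r; first by lia.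
  apply: connect_trans (IHm _ pV _) _; first by lia.
  by apply: connect1; apply/imsetP; exists x; rewrite // !inE x_r.
- rewrite card_in_imset; first by rewrite (cardsD1 r V) rV.
  (* If x and y picked the same edge, each would be the parent of the other. *)
  move=> x y /setD1P[x_r xV] /setD1P[y_r yV] eqE.
  have [_ _ dx] := parP x xV x_r; have [_ _ dy] := parP y yV y_r.
  have : x \in [set p y; y] by rewrite -eqE !inE eqxx orbT.
  rewrite !inE => /orP[/eqP xE|/eqP //].
  have : y \in [set p x; x] by rewrite eqE !inE eqxx orbT.
  rewrite !inE => /orP[/eqP yE|/eqP //].
  by rewrite -xE in dy; rewrite -yE in dx; lia.
Qed.

Lemma steiner_tree_card (T : finType) (e : rel T) (S : {set T}) (H : vepair T) :
  connected_graph e -> H \in steiner_trees e S -> #|H.1| = (steiner_div e S).+1.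
Proof.
move=> ce; rewrite inE => /andP[/and3P[/andP[He HV] Hcon HS] /eqP cardH].
case: H => V F /= in He HV Hcon HS cardH *.
have FV E : E \in F -> E \subset V by move/forall_inP: HV; apply.
have [F' [sF' conF' cardF']] := spanning_tree FV Hcon.
have [_ /(_ (V, F'))] := steiner_divP S ce.
have -> : connects e S (V, F').
  apply/and3P; split=> //; apply/andP; split; first exact: subset_trans He.
  by apply/forall_inP=> E /(subsetP sF')/FV.
move/(_ isT) => /= minF'; rewrite -cardF'; congr _.+1.
by apply/eqP; rewrite eqn_leq minF' -cardH subset_leq_card.
Qed.

Lemma sigma_gt0 (T : finType) (e : rel T) (A : {set T}) :
  connected_graph e -> (0 < sigma e A)%N.
Proof.
move=> ce; have [[H cH cardH] _] := steiner_divP A ce.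
by apply/card_gt0P; exists H; rewrite inE cH cardH eqxx.
Qed.

(** Double counting of the pairs made of a Steiner tree on [A] and one of its
    non-terminal vertices. *)
Lemma sum_sigma_at (T : finType) (e : rel T) (A : {set T}) :
  connected_graph e ->
  (\sum_(v | v \notin A) sigma_at e A v
     = sigma e A * ((steiner_div e A).+1 - #|A|))%N.
Proof.
move=> ce; rewrite /sigma -sum_nat_const.
under eq_bigr => v _ do rewrite /sigma_at -sum1_card big_set big_mkcondr /=.
rewrite exchange_big /=; apply: eq_bigr => H HA.
have AH : A \subset H.1 by move: (HA); rewrite inE => /andP[/and3P[]].
rewrite -(steiner_tree_card ce HA) -(cardsDS AH) -sum1_card -big_mkcondr /=.
by apply: eq_bigl => v; rewrite !inE; case: (v \in A).
Qed.

Lemma steiner_div_ge (T : finType) (e : rel T) (A : {set T}) :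
  connected_graph e -> (#|A| <= (steiner_div e A).+1)%N.
Proof.
move=> ce; have /card_gt0P[H HA] := sigma_gt0 A ce.
rewrite -(steiner_tree_card ce HA) subset_leq_card //.
by move: HA; rewrite inE => /andP[/and3P[]].
Qed.

Lemma sum_BS (T : finType) (e : rel T) :
  connected_graph e ->
  \sum_(v : T) BS e v
    = \sum_(A : {set T} | (2 <= #|A|)%N) ((steiner_div e A)%:R + 1 - #|A|%:R).
Proof.
move=> ce.
rewrite /BS (exchange_big_dep (fun A : {set T} => (2 <= #|A|)%N)) /=; last first.
  by move=> v A _ /andP[].
apply: eq_bigr => A A2.
rewrite (eq_bigl (fun v => v \notin A)) => [|v]; last first.
  by rewrite A2 andbT subsetC sub1set inE.
rewrite -mulr_suml -natr_sum sum_sigma_at // natrM mulrAC mulfV ?mul1r.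
  by rewrite natrB ?steiner_div_ge // -natr1.
by rewrite pnatr_eq0 -lt0n sigma_gt0.
Qed.

Lemma card_sets (T : finType) : #|{: {set T}}| = (2 ^ #|T|)%N.
Proof.
rewrite -[#|T|]cardsT -card_powerset -cardsT; congr #|pred_of_set _|.
by apply/setP=> A; rewrite !inE subsetT.
Qed.

(** Pair each set with its complement. *)
Lemma sum_card_sets (T : finType) :
  ((\sum_(A : {set T}) #|A|).*2 = #|T| * 2 ^ #|T|)%N.
Proof.
rewrite -addnn {2}(reindex_inj (inv_inj (@setCK T))) /= -big_split /=.
under eq_bigr => A _ do rewrite cardsC.
by rewrite sum_nat_const card_sets mulnC.
Qed.

(** Over all sets, [#|A| - 1] sums to [n * 2 ^ n.-1 - 2 ^ n]; singletons
    contribute [0] and the empty set [-1]. *)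
Lemma sum_card_pred (T : finType) :
  (0 < #|T|)%N ->
  \sum_(A : {set T} | (2 <= #|A|)%N) (#|A|%:R - 1)
    = 2 ^+ #|T|.-1 * (#|T|%:R - 2) + 1 :> rat.
Proof.
move=> T_gt0.
have small : \sum_(A : {set T} | ~~ (2 <= #|A|)%N) (#|A|%:R - 1) = -1 :> rat.
  rewrite (bigD1 set0) ?cards0 //= big1 ?addr0 ?sub0r // => A /andP[A1 A0].
  have -> : #|A| = 1%N by rewrite -card_gt0 in A0; lia.
  by rewrite subrr.
have all_sets : \sum_(A : {set T}) (#|A|%:R - 1)
    = 2 ^+ #|T|.-1 * (#|T|%:R - 2) :> rat.
  rewrite sumrB sumr_const card_sets -natr_sum.
  have -> : (\sum_(A : {set T}) #|A| = #|T| * 2 ^ #|T|.-1)%N.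
    apply: double_inj; rewrite sum_card_sets -{2}(prednK T_gt0) expnS.
    by rewrite -mul2n mulnCA.
  by rewrite -{3}(prednK T_gt0) expnS !natrM !natrX; ring.
rewrite -all_sets [X in _ = X + 1](bigID (fun A : {set T} => 2 <= #|A|)%N) /=.
by rewrite small subrK.
Qed.

Unset Implicit Arguments.
Set Strict Implicit.

Theorem corollary8 (T : finType) (e : rel T) (n : nat)
    (e_sym : symmetric e) (e_irr : irreflexive e)
    (e_conn : connected_graph e) (card_T : #|T| = n) (n_ge2 : (2 <= n)%N) :
  avg_BS e =
    n%:R^-1 * ((2 ^+ n - n%:R - 1) * avg_SW e - 2 ^+ n.-1 * (n%:R - 2) - 1).
Proof.
have norm_neq0 : 2 ^+ n - n%:R - 1 != 0 :> rat.
  have lt2n : (n.+1 < 2 ^ n)%N.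
    case: n n_ge2 {card_T} => [|[|n]] // _; elim: n => // n IHn.
    by rewrite expnS; lia.
  by rewrite -addrA -opprD subr_eq0 natr1 -natrX eqr_nat gtn_eqF.
rewrite /avg_BS /avg_SW card_T mulVKf // sum_BS //; congr (_ * _).
have -> : \sum_(A : {set T} | (2 <= #|A|)%N)
      ((steiner_div e A)%:R + 1 - #|A|%:R)
    = (SW e)%:R - \sum_(A : {set T} | (2 <= #|A|)%N) (#|A|%:R - 1) :> rat.
  by rewrite /SW natr_sum -sumrB; apply: eq_bigr => A _; ring.
by rewrite sum_card_pred card_T ?(ltnW n_ge2) // opprD addrA.
Qed.
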